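(* Define $R^{(3)}\colon\mathbb Z_{\ge0}^3\to\mathbb Z_{\ge0}^3$ by \[ R^{(3)}(a,h,c)=\bigl(h+\max(a-c,0),\;\min(a,c),\;h+\max(c-a,0)\bigr). \] For a boundary $(i_1,i_2,i_3,j_1,j_2,j_3)$ and a state $k_1$ of the Schur matching (see context), put $h=\min(k_1,k_2)$ and $m=\min(j_1,j_2)$. (i) Under the deterministic Schur matching $k_1\mapsto k_1'$, the three active occupations transform as \[ (j_1,h,j_2)\longmapsto(k_1',m,k_2')=R^{(3)}(j_1,h,j_2). \] (ii) Consequently, after adjoining the fixed boundary data $(i_1,i_2,i_3,j_1,j_2,j_3)$ needed to reconstruct the remaining arrows through \[ k_1=h+\max(i_1-i_2,0),\quad k_2=h+\max(i_2-i_1,0),\quad k_3=i_3+j_1-k_1,\quad k_3'=j_3+i_1-k_1', \] the Schur matching is the restriction of $R^{(3)}$ to a finite boundary-dependent slice of $\mathbb Z_{\ge0}^3$, namely the set of triples $(j_1,\min(k_1,k_2),j_2)$ with $k_1$ ranging over the admissible states of that boundary. (iii) The map $R^{(3)}$ is an involutive set-theoretic tetrahedron map: $R^{(3)}\circ R^{(3)}=\mathrm{id}$, and, with $R=R^{(3)}$, \[ R_{123}\,R_{145}\,R_{246}\,R_{356}=R_{356}\,R_{246}\,R_{145}\,R_{123}\qquad\text{on }\mathbb Z_{\ge0}^6, \] where $R_{abc}$ applies $R$ to the factors $a,b,c$ (in this order) and acts as the identity on the other three. (iv) Conversely, every triple $(a,h,c)\in\mathbb Z_{\ge0}^3$ arises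 as the active triple $(j_1,\min(k_1,k_2),j_2)$ of the Schur matching for some boundary and some admissible state $k_1$ of it. Thus $R^{(3)}$ on all of $\mathbb Z_{\ge0}^3$ is assembled from the Schur matchings over the various boundaries.
   Context: A boundary is a tuple $(i_1,i_2,i_3,j_1,j_2,j_3)\in\mathbb Z_{\ge0}^6$ with $i_1+j_2+j_3=i_2+i_3+j_1$. For a fixed boundary, the admissible (left) states are the integers $k_1$ with $\max(0,i_1-i_2)\le k_1\le\min(i_3,\,i_3+j_1-j_2)$, and one sets $k_2=i_2+k_1-i_1$, $k_3=i_3+j_1-k_1$. The admissible (right) states are the integers $k_1'$ with $\max(0,j_1-j_2)\le k_1'\le\min(j_3,\,j_3+i_1-i_2)$, and one sets $k_2'=k_1'+j_2-j_1$, $k_3'=j_3+i_1-k_1'$. The (deterministic) Schur matching is the bijection from left states to right states \[ k_1'=j_1-\min(j_1,j_2)+\min(k_1,k_2)=k_1+\max(0,j_1-j_2)-\max(0,i_1-i_2). \] It is the unique bijection preserving the monomial weights $x^{j_2}y^{j_1}(xy)^{\min(k_1,k_2)}$ of left states and $x^{k_2'}y^{k_1'}(xy)^{\min(j_1,j_2)}$ of right states ($x,y$ indeterminates); these are the nonzero summands of the two sides of the Yang--Baxter equation of the vertex model for Schur polynomials with the given boundary. *)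

(* Defs.v *)
From mathcomp Require Import all_boot all_order all_algebra.
From mathcomp Require Import boolp classical_sets functions cardinality.
From mathcomp Require Import zify.

Set Implicit Arguments.
Unset Strict Implicit.
Unset Printing Implicit Defensive.

Import Order.TTheory GRing.Theory Num.Theory.
Local Open Scope classical_set_scope.
Local Open Scope ring_scope.

Record boundary := Boundary {
  i1 : nat; i2 : nat; i3 : nat; j1 : nat; j2 : nat; j3 : nat;
  conservation : (i1 + j2 + j3 = i2 + i3 + j1)%N }.

(* States are integers: the upper bounds below may be negative, so they must  *)
(* not be computed with truncated subtraction.                                *)
Definition left_states (b : boundary) : set int :=
  [set k1 | Num.max 0 ((i1 b)%:Z - (i2 b)%:Z) <= k1 /\
            k1 <= Num.min (i3 b)%:Z ((i3 b)%:Z + (j1 b)%:Z - (j2 b)%:Z)].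

Definition k2 (b : boundary) (k1 : int) : int := (i2 b)%:Z + k1 - (i1 b)%:Z.
Definition k3 (b : boundary) (k1 : int) : int := (i3 b)%:Z + (j1 b)%:Z - k1.

Definition right_states (b : boundary) : set int :=
  [set k1' | Num.max 0 ((j1 b)%:Z - (j2 b)%:Z) <= k1' /\
             k1' <= Num.min (j3 b)%:Z ((j3 b)%:Z + (i1 b)%:Z - (i2 b)%:Z)].

Definition k2' (b : boundary) (k1' : int) : int := k1' + (j2 b)%:Z - (j1 b)%:Z.
Definition k3' (b : boundary) (k1' : int) : int := (j3 b)%:Z + (i1 b)%:Z - k1'.

Definition schur_matching (b : boundary) (k1 : int) : int :=
  (j1 b)%:Z - Num.min (j1 b)%:Z (j2 b)%:Z + Num.min k1 (k2 b k1).

Lemma schur_matchingE b k1 :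
  schur_matching b k1 =
  k1 + Num.max 0 ((j1 b)%:Z - (j2 b)%:Z) - Num.max 0 ((i1 b)%:Z - (i2 b)%:Z).
Proof. rewrite /schur_matching /k2; lia. Qed.

Lemma schur_matching_bij b :
  set_bij (left_states b) (right_states b) (schur_matching b).
Proof.
have cb := conservation b; split.
- by move=> k []; rewrite /right_states /= schur_matchingE; split; lia.
- by move=> k l _ _; rewrite !schur_matchingE; lia.
- move=> k' [lo up].
  exists (k' - Num.max 0 ((j1 b)%:Z - (j2 b)%:Z)
          + Num.max 0 ((i1 b)%:Z - (i2 b)%:Z)); last first.
    by rewrite schur_matchingE; lia.
  by split; lia.
Qed.

Definition triple (T : Type) : Type := (T * T * T)%type.

(* On nat, [a - c] is max(a - c, 0). *)
Definition R3 (t : triple nat) : triple nat :=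
  let: (a, h, c) := t in (h + (a - c), minn a c, h + (c - a))%N.

Definition triple_int (t : triple nat) : triple int :=
  let: (a, h, c) := t in (a%:Z, h%:Z, c%:Z).

Definition left_active (b : boundary) (k1 : int) : triple int :=
  ((j1 b)%:Z, Num.min k1 (k2 b k1), (j2 b)%:Z).

Definition right_active (b : boundary) (k1' : int) : triple int :=
  (k1', Num.min (j1 b)%:Z (j2 b)%:Z, k2' b k1').

Definition slice (b : boundary) : set (triple nat) :=
  [set t | exists2 k1, left_states b k1 & triple_int t = left_active b k1].

Definition left_arrows (b : boundary) (k1 : int) : triple int :=
  (k1, k2 b k1, k3 b k1).

Definition right_arrows (b : boundary) (k1' : int) : triple int :=
  (k1', k2' b k1', k3' b k1').

Definition left_decode (b : boundary) (t : triple nat) : triple int :=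
  let: (_, h, _) := t in
  let k1 := h%:Z + Num.max ((i1 b)%:Z - (i2 b)%:Z) 0 in
  let k2 := h%:Z + Num.max ((i2 b)%:Z - (i1 b)%:Z) 0 in
  (k1, k2, (i3 b)%:Z + (j1 b)%:Z - k1).

Definition right_decode (b : boundary) (t : triple nat) : triple int :=
  let: (k1', _, k2') := t in
  (k1'%:Z, k2'%:Z, (j3 b)%:Z + (i1 b)%:Z - k1'%:Z).

(* Factors are labelled 1, ..., 6. *)
Definition factor (n : nat) : 'I_6 := inord n.-1.

Definition act_on (T : Type) (R : triple T -> triple T) (a b c : nat)
    (x : {ffun 'I_6 -> T}) : {ffun 'I_6 -> T} :=
  let: (y1, y2, y3) := R (x (factor a), x (factor b), x (factor c)) in
  [ffun i => if i == factor a then y1 else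
             if i == factor b then y2 else
             if i == factor c then y3 else x i].

Definition tetrahedron_map (T : Type) (R : triple T -> triple T) : Prop :=
  act_on R 1 2 3 \o act_on R 1 4 5 \o act_on R 2 4 6 \o act_on R 3 5 6 =1
  act_on R 3 5 6 \o act_on R 2 4 6 \o act_on R 1 4 5 \o act_on R 1 2 3.

(* Main.v *)
(** [R3] is the tropical transition map
    (a, h, c) |-> (h + a - min(a, c), min(a, c), h + c - min(a, c)):
    it preserves a + h and h + c and replaces h by min(a, c). These relations
    determine each of the eight factors of the tetrahedron equation, which
    thereby becomes a statement of linear arithmetic with one case
    distinction per factor. For surjectivity onto all triples, the boundary
    with i1 = i2 = 0, i3 = h + c, j1 = a, j2 = c and j3 = h + a has the
    admissible state k1 = k2 = h. *)
Require Import Defs.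
From mathcomp Require Import all_boot all_order all_algebra.
From mathcomp Require Import boolp classical_sets functions cardinality.
From mathcomp Require Import zify.

Set Implicit Arguments.
Unset Strict Implicit.
Unset Printing Implicit Defensive.

Import Order.TTheory GRing.Theory Num.Theory.
Local Open Scope classical_set_scope.
Local Open Scope ring_scope.

Lemma R3_involutive : involutive R3.
Proof. by move=> [[a h] c]; rewrite /R3; congr (_, _, _); lia. Qed.

(** Sums and a disjunction replace truncated subtraction and [minn], so case analysis leaves fresh
    variables under linear constraints. *)
Variant R3_spec (a h c : nat) : triple nat -> Prop :=
  R3Spec y1 y2 y3 of (y1 + y2 = h + a)%N & (y2 + y3 = h + c)%N &
    (y2 = a /\ a <= c)%N \/ (y2 = c /\ c <= a)%N :
  R3_spec a h c (y1, y2, y3).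

Lemma R3P a h c : R3_spec a h c (R3 (a, h, c)).
Proof. by constructor; lia. Qed.

(** A point given by an explicit list lets [act_on] compute as list updates. *)
Definition ffun_of_seq (T : Type) (x0 : T) (s : seq T) : {ffun 'I_6 -> T} :=
  [ffun i : 'I_6 => nth x0 s i].

Lemma ffun_of_seqK (T : Type) (x0 : T) (x : {ffun 'I_6 -> T}) :
  ffun_of_seq x0 (fgraph x) = x.
Proof. by apply/ffunP => i; rewrite ffunE nth_fgraph_ord. Qed.

Lemma ffun6_of_seq (T : Type) (x0 : T) (x : {ffun 'I_6 -> T}) :
  exists x1 x2 x3 x4 x5 x6, x = ffun_of_seq x0 [:: x1; x2; x3; x4; x5; x6].
Proof.
have := ffun_of_seqK x0 x.
have : size (fgraph x) = 6%N by rewrite size_tuple card_ord.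
case: (tval (fgraph x)) => [|x1 [|x2 [|x3 [|x4 [|x5 [|x6 []]]]]]] //= _ <-.
by exists x1, x2, x3, x4, x5, x6.
Qed.

Lemma factor_val n : (0 < n <= 6)%N -> val (factor n) = n.-1.
Proof. by move=> n6; rewrite /factor /= inordK //; lia. Qed.

(** The update at [a] is outermost because [act_on] tests [a] first. *)
Lemma act_on_seq (T : Type) (x0 : T) (R : triple T -> triple T) (a b c : nat)
    (s : seq T) :
  (0 < a <= 6)%N -> (0 < b <= 6)%N -> (0 < c <= 6)%N ->
  act_on R a b c (ffun_of_seq x0 s) =
  let: (y1, y2, y3) := R (nth x0 s a.-1, nth x0 s b.-1, nth x0 s c.-1) in
  ffun_of_seq x0
    (set_nth x0 (set_nth x0 (set_nth x0 s c.-1 y3) b.-1 y2) a.-1 y1).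
Proof.
move=> /factor_val va /factor_val vb /factor_val vc.
rewrite /act_on /ffun_of_seq !ffunE va vb vc; case: (R _) => [[y1 y2] y3].
apply/ffunP => i; rewrite !ffunE.
rewrite -!(inj_eq val_inj) va vb vc.
by rewrite nth_set_nth /= nth_set_nth /= nth_set_nth.
Qed.

(** Keeps the pending factors folded while [/=] computes the list. *)
Local Arguments act_on : simpl never.

Lemma R3_tetrahedron : tetrahedron_map R3.
Proof.
move=> x; have [x1 [x2 [x3 [x4 [x5 [x6 ->]]]]]] := ffun6_of_seq 0%N x.
rewrite /comp.
(* Four maps on each side; each pass treats an innermost one. *)
do 8 (rewrite act_on_seq; [case: R3P => /= ? ? ? ? ? ? | by []..]).
by congr (ffun_of_seq _ [:: _; _; _; _; _; _]); lia.
Qed.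

(** The lower bound on [k] makes both [k] and [k2 b k] nonnegative, so the absolute value of their
    minimum is that minimum. *)
Lemma left_active_nat b k : left_states b k ->
  exists h : nat, triple_int (j1 b, h, j2 b) = left_active b k.
Proof.
move=> -[lo up]; exists `|Num.min k (k2 b k)|%N.
by congr (_, _, _); rewrite /k2; lia.
Qed.

(** Both outer entries come from j - min(j1, j2) + h, with j = j1 and j = j2. *)
Lemma R3_schur_matching b k t : triple_int t = left_active b k ->
  triple_int (R3 t) = right_active b (schur_matching b k).
Proof.
case: t => [[a h] c] -[ea eh ec].
by congr (_, _, _); rewrite /schur_matching /k2'; lia.
Qed.

(** Since k1 - k2 = i1 - i2, the excess of k1 over min(k1, k2) is max(i1 - i2, 0), and symmetrically
    for k2. *)
Lemma left_decode_active b k t : triple_int t = left_active b k ->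
  left_decode b t = left_arrows b k.
Proof.
case: t => [[a h] c] -[_ eh _].
by rewrite /k2 in eh; congr (_, _, _); rewrite /k2 /k3; lia.
Qed.

Lemma right_decode_active b k t : triple_int t = right_active b k ->
  right_decode b t = right_arrows b k.
Proof. by case: t => [[a h] c] -[ea _ ec]; rewrite /= ea ec. Qed.

Lemma finite_slice b : finite_set (slice b).
Proof.
(* Only h varies, and h <= k1 <= i3. *)
apply: (@sub_finite_set _ _ ((fun h => (j1 b, h, j2 b)) @` `I_(i3 b).+1)).
  move=> [[a h] c] [k [lo up]] -[ea eh ec].
  exists h; first by rewrite /=; lia.
  by congr (_, _, _); lia.
by apply: finite_image; exact: finite_II.
Qed.

Lemma left_decode_bij b :
  set_bij (slice b) (left_arrows b @` left_states b) (left_decode b).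
Proof.
split.
- by move=> t [k bk tk]; exists k => //; rewrite (left_decode_active tk).
- move=> t u /set_mem[k _ tk] /set_mem[l _ ul].
  rewrite (left_decode_active tk) (left_decode_active ul) => -[kl _ _].
  (* Equal states have equal active triples, and [triple_int] is injective. *)
  move: tk; rewrite kl -ul.
  by case: t u {ul} => [[a h] c] [[a' h'] c'] [-> -> ->].
- move=> _ [k bk <-]; have [h hk] := left_active_nat bk.
  by exists (j1 b, h, j2 b); [exists k | exact: left_decode_active].
Qed.

Lemma right_decode_bij b :
  set_bij (R3 @` slice b) (right_arrows b @` right_states b) (right_decode b).
Proof.
have [sub _ surj] := schur_matching_bij b.
split.
- move=> _ [t [k bk tk] <-]; exists (schur_matching b k); first exact: sub.
  by rewrite (right_decode_active (R3_schur_matching tk)).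
- move=> _ _ /set_mem[t [k _ tk] <-] /set_mem[u [l _ ul] <-].
  move: tk ul => /R3_schur_matching tk /R3_schur_matching ul.
  rewrite (right_decode_active tk) (right_decode_active ul) => -[kl _ _].
  move: tk; rewrite kl -ul.
  by case: (R3 t) (R3 u) => [[a h] c] [[a' h'] c'] [-> -> ->].
(* Every right state is the match of some left state [k], whose active triple [R3] sends to the
   required one. *)
- move=> _ [_ /surj[k bk <-] <-]; have [h hk] := left_active_nat bk.
  exists (R3 (j1 b, h, j2 b)); first by exists (j1 b, h, j2 b) => //; exists k.
  exact: right_decode_active (R3_schur_matching hk).
Qed.

Theorem proposition4p5 :
  (* (i) *)
  (forall (b : boundary) (k1 : int), left_states b k1 ->
     exists h : nat,
       h%:Z = Num.min k1 (k2 b k1) /\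
       triple_int (R3 (j1 b, h, j2 b)) =
         (schur_matching b k1, (minn (j1 b) (j2 b))%:Z,
          k2' b (schur_matching b k1))) /\
  (* (ii) *)
  (forall b : boundary,
     (forall k1 : int, left_states b k1 ->
        let h := Num.min k1 (k2 b k1) in
        let k1' := schur_matching b k1 in
        [/\ k1 = h + Num.max ((i1 b)%:Z - (i2 b)%:Z) 0,
            k2 b k1 = h + Num.max ((i2 b)%:Z - (i1 b)%:Z) 0,
            k3 b k1 = (i3 b)%:Z + (j1 b)%:Z - k1 &
            k3' b k1' = (j3 b)%:Z + (i1 b)%:Z - k1']) /\
     [/\ finite_set (slice b),
         set_bij (slice b) (left_arrows b @` left_states b) (left_decode b),
         set_bij (R3 @` slice b) (right_arrows b @` right_states b)
           (right_decode b) &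
         forall (t : triple nat) (k1 : int), slice b t -> left_states b k1 ->
           left_decode b t = left_arrows b k1 ->
           triple_int t = left_active b k1 /\
           triple_int (R3 t) = right_active b (schur_matching b k1) /\
           right_decode b (R3 t) = right_arrows b (schur_matching b k1)]) /\
  (* (iii) *)
  (involutive R3 /\ tetrahedron_map R3) /\
  (* (iv) *)
  (forall a h c : nat, exists (b : boundary) (k1 : int),
     [/\ left_states b k1,
         (a%:Z, h%:Z, c%:Z) = left_active b k1 &
         triple_int (R3 (a, h, c)) = right_active b (schur_matching b k1)]).
Proof.
split=> [b k bk|].
  have [h hk] := left_active_nat bk; exists h.
  case: (hk) => eh; split=> //.
  by rewrite (R3_schur_matching hk) /right_active; congr (_, _, _); lia.
split=> [b|].
  split=> [k bk h k'|].
    by rewrite /h /k2 /k3 /k3'; split=> //; lia.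
  split; [exact: finite_slice | exact: left_decode_bij
         | exact: right_decode_bij |].
  (* The first arrow identifies the state [l] witnessing membership in the slice with [k]. *)
  move=> t k [l _ tl] _; rewrite (left_decode_active tl) => -[lk _ _].
  rewrite lk in tl; have R3tl := R3_schur_matching tl.
  by split=> //; split=> //; exact: right_decode_active.
split; first by split; [exact: R3_involutive | exact: R3_tetrahedron].
move=> a h c.
have cons : (0 + c + (h + a) = 0 + (h + c) + a)%N by lia.
pose b := Boundary cons; have hb : triple_int (a, h, c) = left_active b h%:Z.
  by congr (_, _, _); rewrite /k2 /=; lia.
exists b, h%:Z; split=> //; last exact: R3_schur_matching.
(* The bounds read 0 <= h <= h + min(a, c). *)
by split; rewrite /=; lia.
Qed.
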